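(* Suppose that $A$ is a super-amenable Banach algebra. Then the following statements hold. (1) $A^{**}$ is a Connes-amenable Banach algebra with respect to the first Arens product. (2) If $A$ has a bounded left approximate identity, then for every Banach $A$-bimodule $B$ with predual $X$ such that $AB^*\subseteq X$ and $B^*A\subseteq X$, one has $H^1_{w^*}(A^{**},B^{**})=0$.
   Context: A derivation from a Banach algebra $C$ into a Banach $C$-bimodule $E$ is a bounded linear map $D:C\to E$ with $D(xy)=xD(y)+D(x)y$; it is inner if $D(c)=ce-ec$ for some fixed $e\in E$; $H^1(C,E)$ is the quotient of the space of derivations by the space of inner derivations. $A$ is super-amenable if $H^1(A,E)=0$ for every Banach $A$-bimodule $E$. The first Arens product on $A^{**}$ is $a''b''=w^*\text{-}\lim_\alpha w^*\text{-}\lim_\beta a_\alpha b_\beta$ for bounded nets in $A$ with $a_\alpha\to a''$, $b_\beta\to b''$ weak$^*$. $B^{**}$ is a Banach $A^{**}$-bimodule by $a''b''=w^*\text{-}\lim_\alpha w^*\text{-}\lim_\beta a_\alpha b_\beta$ and $b''a''=w^*\text{-}\lim_\beta w^*\text{-}\lim_\alpha b_\beta a_\alpha$ (bounded nets $a_\alpha\to a''$ in $A$, $b_\beta\to b''$ in $B$, weak$^*$). A dual Banach bimodule $E$ over a Banach algebra $C$ carrying a weak$^*$ topology (here $C=A^{**}$ with $\sigma(A^{**},A^* )$) is called normal if for each $x\in E$ the maps $c\mapsto cx$ and $c\mapsto xc$ from $C$ into $E$ are weak$^*$-to-weak$^*$ continuous. $C$ is Connes-amenable if, for every normal dual Banach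 $C$-bimodule $E$, every weak$^*$-to-weak$^*$ continuous derivation $C\to E$ is inner. $H^1_{w^*}(C,E)=0$ means that every weak$^*$-to-weak$^*$ continuous derivation from $C$ into the dual space $E$ is inner. ''$B$ has predual $X$'' means $B=X^*$; $X$ is regarded as a subspace of $X^{**}=B^*$. $B^*$ is an $A$-bimodule by $\langle b'a,b\rangle=\langle b',ab\rangle$, $\langle ab',b\rangle=\langle b',ba\rangle$; $AB^*=\{ab'\}$, $B^*A=\{b'a\}$. *)

(* Defs.v *)
From HB Require Import structures.
From mathcomp Require Import all_boot all_order all_algebra.
From mathcomp Require Import complex ring lra.
From mathcomp Require Import all_classical all_reals all_analysis.

Set Implicit Arguments.
Unset Strict Implicit.
Unset Printing Implicit Defensive.

Import Order.TTheory GRing.Theory Num.Theory.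
Import numFieldNormedType.Exports.

Local Open Scope classical_set_scope.
Local Open Scope complex_scope.
Local Open Scope ring_scope.

(* Norms of normed modules over R[i] take values in R[i]; [rnorm] is the same
   norm seen in R. *)
Definition rnorm (R : realType) (X : normedModType R[i]) (x : X) : R :=
  complex.Re `|x|.

Section RealNorm.
Context {R : realType}.
Implicit Type X : normedModType R[i].

Lemma rnormE X (x : X) : `|x| = (rnorm x)%:C.
Proof. by rewrite RRe_real// normr_real. Qed.

Lemma rnorm_ge0 X (x : X) : 0 <= rnorm x.
Proof. by rewrite -ler0c -rnormE normr_ge0. Qed.

Lemma ler_rnorm X (x : X) (r : R) : (`|x| <= r%:C) = (rnorm x <= r).
Proof. by rewrite rnormE lecR. Qed.

Lemma rnormD X (x y : X) : rnorm (x + y) <= rnorm x + rnorm y.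
Proof. by rewrite -lecR rmorphD /= -!rnormE ler_normD. Qed.

Lemma rnormN X (x : X) : rnorm (- x) = rnorm x.
Proof. by rewrite /rnorm normrN. Qed.

Lemma rnormZ X (k : R[i]) (x : X) : rnorm (k *: x) = rnorm (k : R[i]^o) * rnorm x.
Proof. by apply: complexI; rewrite rmorphM /= -!rnormE normrZ. Qed.

Lemma rnorm0 X : rnorm (0 : X) = 0.
Proof. by rewrite /rnorm normr0. Qed.

Lemma rnorm0_eq0 X (x : X) : rnorm x = 0 -> x = 0.
Proof. by move=> x0; apply: normr0_eq0; rewrite rnormE x0. Qed.

Lemma rnormM (k l : R[i]) :
  rnorm (k * l : R[i]^o) = rnorm (k : R[i]^o) * rnorm (l : R[i]^o).
Proof. exact: (rnormZ k (l : R[i]^o)). Qed.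

Lemma rnorm_real (r : R) : rnorm (r%:C : R[i]^o) = `|r|.
Proof. by rewrite /rnorm /= expr0n /= addr0 sqrtr_sqr. Qed.

Lemma cvg_rnormP (T : Type) (F : set_system T) (FF : Filter F) X (f : T -> X) (l : X) :
  f @ F --> l <-> (forall e : R, 0 < e -> \forall t \near F, rnorm (l - f t) < e).
Proof.
split=> [/cvgrPdist_lt h e e0|h].
  have /h : 0 < e%:C by rewrite ltcR.
  by apply: filterS => t; rewrite rnormE ltcR.
apply/cvgrPdist_lt => e e0.
have eE : e = (complex.Re e)%:C by rewrite RRe_real// gtr0_real.
have e1 : 0 < complex.Re e by rewrite -ltcR -eE.
by apply: filterS (h _ e1) => t; rewrite rnormE eE ltcR.
Qed.

Lemma ler_Re_rnorm (z : R[i]) : `|complex.Re z| <= rnorm (z : R[i]^o).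
Proof.
case: z => a b; rewrite /rnorm /= -sqrtr_sqr ler_wsqrtr// lerDl; exact: sqr_ge0.
Qed.

Lemma ler_Im_rnorm (z : R[i]) : `|complex.Im z| <= rnorm (z : R[i]^o).
Proof.
case: z => a b; rewrite /rnorm /= -sqrtr_sqr ler_wsqrtr// lerDr; exact: sqr_ge0.
Qed.

Lemma rnorm_le_ReIm (z : R[i]) :
  rnorm (z : R[i]^o) <= `|complex.Re z| + `|complex.Im z|.
Proof.
rewrite [z in leLHS]complexE -[`|complex.Re z|]rnorm_real.
apply: (le_trans (rnormD _ _)); rewrite lerD2l rnormM rnorm_real.
by rewrite /rnorm /= expr0n expr1n /= add0r sqrtr1 mul1r.
Qed.

Lemma complex_cauchy_cvg (F : set_system R[i]^o) : ProperFilter F ->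
  (forall e : R, 0 < e -> exists2 A, F A &
     forall z w, A z -> A w -> rnorm (z - w : R[i]^o) <= e) ->
  exists l : R[i]^o, F --> l.
Proof.
move=> PF cF.
have real_part (g : R[i] -> R) : (forall z w, g (z - w) = g z - g w) ->
    (forall z, `|g z| <= rnorm (z : R[i]^o)) -> exists l : R, g @ F --> l.
  move=> gB gle; apply/cvg_ex; apply: R_complete.
  apply/cauchy_ballP => e e0.
  have e20 : 0 < e / 2 by rewrite divr_gt0.
  have [A FA Ae] := cF _ e20.
  exists (g @` A, g @` A); first by split; apply: (@filterS _ F _ A) => // z Az; exists z.
  move=> [_ _] [/= [z Az <-] [w Aw <-]]; rewrite /ball /= -gB.
  apply: le_lt_trans (gle _) _; apply: le_lt_trans (Ae _ _ Az Aw) _.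
  by rewrite ltr_pdivrMr// ltr_pMr// ltr1n.
have [a Fa] := real_part (@complex.Re R) (fun z w => raddfB (@complex.Re R : Rcomplex R -> R) z w) ler_Re_rnorm.
have [b Fb] := real_part (@complex.Im R) (fun z w => raddfB (@complex.Im R : Rcomplex R -> R) z w) ler_Im_rnorm.
exists (a +i* b); apply/(cvg_rnormP PF (id : R[i]^o -> R[i]^o)) => e e0.
have e20 : 0 < e / 2 by rewrite divr_gt0.
move/cvgrPdist_lt : Fa => /(_ _ e20) Fa.
move/cvgrPdist_lt : Fb => /(_ _ e20) Fb.
apply: filterS2 Fa Fb => -[x y] /= ax yb.
by rewrite (le_lt_trans (rnorm_le_ReIm _))//= (splitr e) ltrD.
Qed.

End RealNorm.

Definition bounded_linear (R : realType) (X Y : normedModType R[i])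
    (f : X -> Y) : Prop :=
  linear f /\ exists M : R, forall x, `|f x| <= M%:C * `|x|.

Definition dual_pred (R : realType) (X : normedModType R[i]) :
    {pred X -> R[i]^o} :=
  fun f => `[< @bounded_linear R X R[i]^o f >].
Arguments dual_pred {R} X _.

Record dual (R : realType) (X : normedModType R[i]) : Type := Dual {
  dual_fun :> X -> R[i]^o;
  dual_funP : dual_fun \in dual_pred X }.

Section Dual.
Context {R : realType} {X : normedModType R[i]}.
Implicit Types f g : dual X.

HB.instance Definition _ := [isSub for @dual_fun R X].
HB.instance Definition _ := [Choice of dual X by <:].

Lemma bounded_linear_rnorm (Y : normedModType R[i]) (f : X -> Y) :
  bounded_linear f <->
  linear f /\ exists2 M : R, 0 <= M & forall x, rnorm (f x) <= M * rnorm x.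
Proof.
split=> -[lf].
  move=> [M fM]; split => //; exists `|M| => // x; rewrite -ler_rnorm.
  apply: le_trans (fM x) _; rewrite rnormE -rmorphM lecR.
  by rewrite ler_wpM2r ?rnorm_ge0 ?ler_norm.
move=> [M M0 fM]; split => //; exists M => x.
by rewrite [X in _ * X]rnormE -rmorphM ler_rnorm.
Qed.

Lemma dual_submod_closed : submod_closed (dual_pred X).
Proof.
split=> [|k f g /asboolP/bounded_linear_rnorm[lf [M M0 fM]]
                /asboolP/bounded_linear_rnorm[lg [N N0 gN]]].
  apply/asboolP; split=> [k x y|]; first by rewrite scaler0 addr0.
  by exists 0 => x; rewrite normr0 mul0r.
apply/asboolP/bounded_linear_rnorm; split=> [l x y|].
  rewrite /= !fctE lf lg !scalerDr !scalerA mulrC addrACA.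
  by congr (_ + _); rewrite -!scalerA -scalerDr scalerA.
exists (rnorm (k : R[i]^o) * M + N) => [|x].
  by rewrite addr_ge0// mulr_ge0// rnorm_ge0.
apply: le_trans (rnormD _ _) _; rewrite mulrDl lerD// rnormZ -mulrA.
by rewrite ler_wpM2l ?rnorm_ge0.
Qed.

HB.instance Definition _ :=
  GRing.isSubmodClosed.Build R[i] (X -> R[i]^o) (dual_pred X) dual_submod_closed.
HB.instance Definition _ := [SubChoice_isSubLmodule of dual X by <:].

Lemma dual_linear f : linear f.
Proof. by have /asboolP[] := dual_funP f. Qed.

HB.instance Definition _ f :=
  GRing.isLinear.Build R[i] X R[i]^o _ (dual_fun f) (dual_linear f).

Lemma dualP f g : f =1 g -> f = g.
Proof. by move=> fg; apply/val_inj/funext. Qed.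

Definition opnorm f : R := sup [set rnorm (f x) | x in [set x | `|x| <= 1]].

Let opnorm_has_sup f :
  has_sup [set rnorm (f x) | x in [set x | `|x| <= 1]].
Proof.
have /asboolP/bounded_linear_rnorm[_ [M M0 fM]] := dual_funP f.
split; first by exists (rnorm (f 0)), 0 => //=; rewrite normr0.
exists M => _ [x /= x1 <-]; apply: le_trans (fM x) _.
by rewrite ler_piMr// -ler_rnorm.
Qed.

Lemma opnorm_ge0 f : 0 <= opnorm f.
Proof.
rewrite -[0 : R](rnorm0 R[i]^o) -(raddf0 f); apply: sup_upper_bound => //.
by exists 0 => //=; rewrite normr0.
Qed.

Lemma ler_opnorm f x : rnorm (f x) <= opnorm f * rnorm x.
Proof.
have [->|x0] := eqVneq x 0; first by rewrite raddf0 !rnorm0 mulr0.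
have rx0 : 0 < rnorm x.
  by rewrite lt_neqAle rnorm_ge0 andbT eq_sym; apply: contra_neq x0 => /rnorm0_eq0.
rewrite -ler_pdivrMr//.
have xE : rnorm ((rnorm x)^-1%:C : R[i]^o) = (rnorm x)^-1.
  by rewrite rnorm_real ger0_norm// invr_ge0 rnorm_ge0.
apply: sup_upper_bound => //=; exists ((rnorm x)^-1%:C *: x) => /=.
  by rewrite ler_rnorm rnormZ xE mulVf// gt_eqF.
by rewrite linearZ /= rnormZ xE mulrC.
Qed.

Lemma opnorm_le f (M : R) : 0 <= M ->
  (forall x, rnorm (f x) <= M * rnorm x) -> opnorm f <= M.
Proof.
move=> M0 fM; apply: ge_sup => [|_ [x /= x1 <-]]; first by case: (opnorm_has_sup f).
by apply: le_trans (fM x) _; rewrite ler_piMr// -ler_rnorm.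
Qed.

Let dnorm f : R[i] := (opnorm f)%:C.

Let dnormD f g : dnorm (f + g) <= dnorm f + dnorm g.
Proof.
rewrite -rmorphD lecR; apply: opnorm_le => [|x]; first by rewrite addr_ge0 ?opnorm_ge0.
by rewrite mulrDl; apply: le_trans (rnormD _ _) _; rewrite lerD ?ler_opnorm.
Qed.

Let dnormZ (k : R[i]) f : dnorm (k *: f) = `|k| * dnorm f.
Proof.
rewrite (rnormE (k : R[i]^o)) -rmorphM; congr (_%:C); apply: le_anti.
have le_opnormZ (l : R[i]) h : opnorm (l *: h) <= rnorm (l : R[i]^o) * opnorm h.
  apply: opnorm_le => [|x]; first by rewrite mulr_ge0 ?opnorm_ge0 ?rnorm_ge0.
  by rewrite rnormZ -mulrA ler_wpM2l ?rnorm_ge0 ?ler_opnorm.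
rewrite le_opnormZ /=; have [->|k0] := eqVneq k 0.
  by rewrite rnorm0 mul0r opnorm_ge0.
have kk : rnorm (k : R[i]^o) * rnorm (k^-1 : R[i]^o) = 1.
  by rewrite -rnormM mulfV// (rnorm_real 1) normr1.
rewrite -{1}[f](scalerK k0) -[leRHS]mul1r -kk -mulrA.
by rewrite ler_wpM2l ?rnorm_ge0 ?le_opnormZ.
Qed.

Let dnorm0_eq0 f : dnorm f = 0 -> f = 0.
Proof.
move=> /complexI f0; apply: dualP => x; apply: rnorm0_eq0; apply: le_anti.
by rewrite rnorm_ge0 (le_trans (ler_opnorm _ _))// f0 mul0r.
Qed.

HB.instance Definition _ :=
  Lmodule_isNormed.Build R[i] (dual X) dnormD dnormZ dnorm0_eq0.

Lemma rnorm_dualE f : rnorm f = opnorm f.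
Proof. by []. Qed.

Let dual_complete (F : set_system (dual X)) : ProperFilter F -> cauchy F -> cvg F.
Proof.
move=> PF /cauchy_ballP cF.
have cF' (e : R) : 0 < e -> exists2 A : set (dual X), F A &
    forall f g x, A f -> A g -> rnorm (f x - g x) <= e * rnorm x.
  move=> e0; have /cF[[A B] /= [FA FB] ABe] : 0 < (e / 2)%:C by rewrite ltcR divr_gt0.
  have ABe' f g : A f -> B g -> rnorm (f - g) <= e / 2.
    move=> Af Bg; have := ABe (f, g) (conj Af Bg).
    by rewrite -ball_normE /ball_ /= rnormE ltcR => /ltW.
  exists (A `&` B) => [|f g x [Af Bf] [Ag Bg]]; first exact: filterI.
  rewrite -[f x - g x]/((f - g) x); apply: le_trans (ler_opnorm _ _) _.
  rewrite ler_wpM2r ?rnorm_ge0// -rnorm_dualE.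
  rewrite -[f - g](subrKA f) -[f - f]opprB [e in leRHS]splitr.
  by apply: le_trans (rnormD _ _) _; rewrite rnormN lerD// ABe'.
have /choice[l Fl] x : exists l : R[i]^o, (fun f : dual X => f x) @ F --> l.
  apply: complex_cauchy_cvg => e e0.
  have rx : 0 < rnorm x + 1 by rewrite ltr_wpDl ?rnorm_ge0.
  have [A FA Ae] := cF' _ (divr_gt0 e0 rx).
  exists [set f x | f in A]; first by apply: (@filterS _ F _ A) => // f Af; exists f.
  move=> _ _ [f Af <-] [g Ag <-]; apply: le_trans (Ae _ _ _ Af Ag) _.
  by rewrite mulrAC ler_pdivrMr// ler_pM2l// lerDl.
have Al (e : R) : 0 < e -> exists2 A : set (dual X), F A &
    forall f x, A f -> rnorm (l x - f x) <= e * rnorm x.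
  move=> e0; have [A FA Ae] := cF' _ e0; exists A => // f x Af.
  apply/ler_addgt0Pr => d d0; move/cvg_rnormP : (Fl x) => /(_ _ d0) lx.
  have [g [/= lgx Ag]] := filter_ex (filterI lx FA).
  rewrite -[l x](subrK (g x)) -addrA addrC.
  by apply: le_trans (rnormD _ _) _; rewrite lerD ?(ltW lgx)// Ae.
have ll : linear l.
  move=> k x y; apply: (cvg_unique _ (Fl _)) => //.
  have -> : (fun f : dual X => f (k *: x + y)) = (fun f => k *: f x + f y).
    by apply/funext => f; exact: dual_linear.
  apply: cvgD; last exact: Fl.
  by apply: cvgZl_tmp; exact: Fl.
have lb : l \in dual_pred X.
  apply/asboolP/bounded_linear_rnorm; split => //.
  have [A FA Ae] := Al 1 ltr01; have [f Af] := filter_ex FA.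
  exists (1 + opnorm f) => [|x]; first by rewrite addr_ge0 ?opnorm_ge0.
  rewrite -[l x](subrK (f x)) mulrDl; apply: le_trans (rnormD _ _) _.
  by rewrite lerD ?Ae ?ler_opnorm.
apply/cvg_ex; exists (Dual lb).
apply/(cvg_rnormP PF (id : dual X -> dual X)) => e e0.
have [A FA Ae] := Al _ (divr_gt0 e0 (ltr0n R 2)).
apply: filterS FA => f Af; apply: (@le_lt_trans _ _ (e / 2)).
  by rewrite rnorm_dualE; apply: opnorm_le => [|x]; [rewrite ltW// divr_gt0|exact: Ae].
by rewrite ltr_pdivrMr// ltr_pMr// ltr1n.
Qed.

HB.instance Definition _ := Uniform_isComplete.Build (dual X) dual_complete.

End Dual.

Section DualConstructions.
Context {R : realType}.
Implicit Types X Y Z : normedModType R[i].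

Definition dual_of X (f : X -> R[i]^o) (bf : bounded_linear f) : dual X :=
  Dual (asboolT bf).

Lemma bidual_embed_bounded X (x : X) :
  @bounded_linear R (dual X) R[i]^o (fun f => f x).
Proof.
apply/bounded_linear_rnorm; split => //.
by exists (rnorm x) => [|f]; rewrite ?rnorm_ge0// mulrC ler_opnorm.
Qed.

Definition bidual_embed X (x : X) : dual (dual X) := dual_of (bidual_embed_bounded x).

(* The weak* topology sigma(X^*, X), i.e. the topology of pointwise
   convergence on X. *)
Definition wstar X : topologicalType :=
  initial_topology (fun f : dual X => (f : {ptws X -> R[i]^o})).

Lemma cvg_wstarP X (T : Type) (F : set_system T) (FF : Filter F)
    (f : T -> dual X) (l : dual X) :
  ((f t : wstar X) @[t --> F] --> (l : wstar X)) <->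
  (forall x, f t x @[t --> F] --> l x).
Proof.
pose ev (g : dual X) : {ptws X -> R[i]^o} := g.
split=> [fl x|fl].
  have : {ptws, (fun t => ev (f t)) @ F --> ev l}.
    exact: (cvg_comp f ev fl (@initial_continuous _ _ ev l)).
  by move/pointwise_cvgP => /(_ x).
have {fl} : {ptws, (fun t => ev (f t)) @ F --> ev l} by apply/pointwise_cvgP.
move=> fl A /= [_ [[B oB <-] Bl BA]].
have : nbhs (ev l) B by rewrite nbhsE; exists B.
move=> /fl FB; rewrite nbhs_filterE; apply: (@filterS _ F _ _ _ _ FB) => t.
exact: BA.
Qed.

End DualConstructions.

Section Goldstine.
Context {R : realType}.
Variable X : normedModType R[i].

Let rnorm_sqrB (w u : R[i]) (t : R) :
  rnorm (w - t%:C * u : R[i]^o) ^+ 2 =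
  rnorm (w : R[i]^o) ^+ 2 - t * complex.Re (w^* * u) *+ 2
  + t ^+ 2 * rnorm (u : R[i]^o) ^+ 2.
Proof.
case: w u => [a b] [c d]; rewrite /rnorm /= !sqr_sqrtr ?addr_ge0 ?sqr_ge0//.
by rewrite !mul0r; ring.
Qed.

Let rnorm_sqr (w : R[i]) : rnorm (w : R[i]^o) ^+ 2 = complex.Re (w^* * w).
Proof.
by case: w => [a b]; rewrite /rnorm /= sqr_sqrtr ?addr_ge0 ?sqr_ge0//; ring.
Qed.

Let phase (z : R[i]) : exists2 c : R[i],
  rnorm (c : R[i]^o) <= 1 & c * z = (rnorm (z : R[i]^o))%:C.
Proof.
have [->|z0] := eqVneq z 0.
  by exists 0; rewrite ?mul0r rnorm0 ?ler01.
have nz0 : rnorm (z : R[i]^o) != 0.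
  by apply: contra_neq z0 => /(@rnorm0_eq0 _ R[i]^o).
exists ((rnorm (z : R[i]^o))%:C / z); last by rewrite mulfVK.
rewrite rnormM rnorm_real ger0_norm ?rnorm_ge0//.
have : rnorm (z : R[i]^o) * rnorm (z^-1 : R[i]^o) = 1.
  by rewrite -rnormM mulfV// (rnorm_real 1) normr1.
by move=> ->.
Qed.

Variable phi : dual (dual X).
Let M : R := rnorm phi.
Let M0 : 0 <= M. Proof. exact: rnorm_ge0. Qed.

Let q (s : seq (dual X)) (x : X) : R :=
  \sum_(f <- s) rnorm (phi f - f x : R[i]^o) ^+ 2.

Let goldstine_sqr (s : seq (dual X)) (e : R) : 0 < e ->
  exists2 x, rnorm x <= M & q s x < e.
Proof.
move=> e0; pose S := [set q s x | x in [set x | rnorm x <= M]].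
have q0 x : 0 <= q s x by apply: sumr_ge0 => f _; exact: sqr_ge0.
have hS : has_inf S.
  by split; [exists (q s 0), 0; rewrite //= rnorm0|exists 0 => _ [x _ <-]].
pose d := inf S.
have dS x : rnorm x <= M -> d <= q s x.
  by move=> xM; apply: ge_inf; [case: hS|exists x].
have approx (eta : R) : 0 < eta -> exists2 x, rnorm x <= M & q s x < d + eta.
  by move=> eta0; have [_ [x xM <-]] := inf_adherent eta0 hS; exists x.
have [d0|d0] := leP d 0.
  by have [x xM xe] := approx _ e0; exists x => //; rewrite (lt_le_trans xe)// gerDr.
exfalso.
pose L := \sum_(f <- s) (opnorm f * (M + M)) ^+ 2.
have L0 : 0 <= L by apply: sumr_ge0 => f _; exact: sqr_ge0.
pose t : R := Num.min 1 (d / 2 / (L + 1)).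
have L10 : 0 < L + 1 by rewrite ltr_wpDl.
have t0 : 0 < t by rewrite lt_min ltr01 !divr_gt0.
have t1 : t <= 1 by rewrite ge_min lexx.
have tL : t * L <= d / 2.
  apply: (@le_trans _ _ (d / 2 / (L + 1) * L)).
    by rewrite ler_wpM2r// ge_min lexx orbT.
  by rewrite mulrAC ler_pdivrMr// ler_pM2l ?divr_gt0// lerDl.
have td0 : 0 < t * (d / 2) by rewrite mulr_gt0// divr_gt0.
have [x xM qx] := approx _ td0.
pose w f : R[i] := phi f - f x.
pose g : dual X := \sum_(f <- s) (w f)^* *: f.
have gE y : g y = \sum_(f <- s) (w f)^* * f y.
  rewrite /g; elim: (s) => [|f r IH]; first by rewrite !big_nil.
  by rewrite !big_cons -IH.
have phigE : phi g = \sum_(f <- s) (w f)^* * phi f.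
  by rewrite /g linear_sum; apply: eq_bigr => f _; rewrite linearZ.
have ReS (h : dual X -> R[i]) :
    complex.Re (\sum_(f <- s) h f) = \sum_(f <- s) complex.Re (h f).
  exact: (raddf_sum (@complex.Re R : Rcomplex R -> R)).
have gy y : rnorm y <= M -> complex.Re (g y) <= complex.Re (g x) + d / 2.
  move=> yM; pose z := x + t%:C *: (y - x).
  have zM : rnorm z <= M.
    have -> : z = (1 - t)%:C *: x + t%:C *: y.
      by rewrite /z rmorphB /= scalerBl scale1r scalerBr addrA addrAC.
    apply: le_trans (rnormD _ _) _; rewrite !rnormZ !rnorm_real.
    have t1' : 0 <= 1 - t by rewrite subr_ge0.
    rewrite (ger0_norm t1') (ger0_norm (ltW t0)).
    have -> : M = (1 - t) * M + t * M by ring.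
    by apply: lerD; rewrite ler_wpM2l// ltW.
  have := dS _ zM.
  have -> : q s z = q s x - t * complex.Re (g (y - x)) *+ 2
      + t ^+ 2 * \sum_(f <- s) rnorm (f (y - x)) ^+ 2.
    rewrite gE ReS /q !mulr_sumr -sumrMnl -sumrB -big_split /=.
    apply: eq_bigr => f _; rewrite -rnorm_sqrB; congr (rnorm _ ^+ 2).
    by rewrite /z linearD linearZ /= opprD addrA.
  have SL : \sum_(f <- s) rnorm (f (y - x)) ^+ 2 <= L.
    apply: ler_sum => f _; rewrite ler_sqr ?nnegrE ?rnorm_ge0//; last first.
      by rewrite mulr_ge0 ?opnorm_ge0// addr_ge0.
    apply: le_trans (ler_opnorm _ _) _; rewrite ler_wpM2l ?opnorm_ge0//.
    by apply: le_trans (rnormD _ _) _; rewrite rnormN lerD.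
  rewrite (linearB g) /= (raddfB (@complex.Re R : Rcomplex R -> R)) /=.
  set a := complex.Re (g y); set b := complex.Re (g x).
  set T := \sum_(f <- s) _ in SL *.
  move=> dle.
  have tT : t ^+ 2 * T <= t * (d / 2).
    rewrite expr2 -mulrA ler_pM2l//; apply: le_trans tL.
    by rewrite ler_pM2l.
  have : t * (a - b) <= t * (d / 2) by lra.
  by rewrite ler_pM2l//; lra.
have Mg : M * opnorm g <= complex.Re (g x) + d / 2.
  have C0 : 0 <= complex.Re (g x) + d / 2.
    by apply: le_trans (gy 0 _); rewrite ?raddf0 ?rnorm0.
  have [M00|M00] := eqVneq M 0; first by rewrite M00 mul0r.
  have Mp : 0 < M by rewrite lt_neqAle eq_sym M00.
  rewrite -ler_pdivlMl//; apply: ge_sup => [|_ [y /= y1 <-]].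
    by exists (rnorm (g 0)), 0 => //=; rewrite normr0.
  rewrite ler_pdivlMl//.
  have [c c1 cg] := phase (g y).
  have := gy ((M%:C * c) *: y); rewrite linearZ /= -[X in complex.Re X]mulrA cg.
  rewrite -rmorphM /=; apply; rewrite rnormZ rnormM rnorm_real ger0_norm//.
  rewrite -mulrA ler_piMr// mulr_ile1 ?rnorm_ge0//.
  by rewrite -ler_rnorm.
have : complex.Re (phi g) <= M * opnorm g.
  by apply: le_trans (ler_opnorm phi g); apply: le_trans (ler_norm _) (ler_Re_rnorm _).
have -> : complex.Re (phi g) = complex.Re (g x) + q s x.
  rewrite phigE gE !ReS /q -big_split /=; apply: eq_bigr => f _.
  rewrite rnorm_sqr -(raddfD (@complex.Re R : Rcomplex R -> R)); congr complex.Re.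
  by rewrite -[RHS]mulrDr addrC subrK.
by have := dS _ xM; lra.
Qed.

(* Goldstine's theorem: every element of X^** is the weak* limit of a bounded
   net in X. *)
Lemma goldstine : exists (I : Type) (F : set_system I) (x : I -> X),
  [/\ ProperFilter F, (forall i, `|x i| <= `|phi|) &
      (bidual_embed (x i) : wstar (dual X)) @[i --> F] --> (phi : wstar (dual X))].
Proof.
pose I := (seq (dual X) * nat)%type.
have /choice[x xP] (i : I) : exists x, rnorm x <= M /\ q i.1 x < i.2.+1%:R^-1 ^+ 2.
  have e0 : 0 < i.2.+1%:R^-1 ^+ 2 :> R by rewrite exprn_gt0// invr_gt0 ltr0n.
  by have [x] := goldstine_sqr i.1 e0; exists x.
pose tail (i : I) : set I := [set j : seq (dual X) * nat | {subset i.1 <= j.1} /\ (i.2 <= j.2)%N].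
pose F : set_system I := [set A | exists i, tail i `<=` A].
have PF : ProperFilter F.
  apply: Build_ProperFilter_ex => [A [i iA]|]; first by exists i; apply: iA; split.
  split=> [|A B [i iA] [j jB]|A B AB [i iA]].
  - by exists ([::], 0%N).
  - exists (i.1 ++ j.1, maxn i.2 j.2) => k /= [ijk]; rewrite geq_max => /andP[ik jk].
    split; [apply: iA|apply: jB]; split=> // f fi; apply: ijk.
      by rewrite mem_cat fi.
    by rewrite mem_cat fi orbT.
  - by exists i; exact: subset_trans AB.
exists I, F, x; split => // [i|].
  by rewrite [leRHS]rnormE ler_rnorm; case: (xP i).
apply/cvg_wstarP => f; apply/cvg_rnormP => e e0.
have [n ne] : exists n : nat, n.+1%:R^-1 < e.
  have [n] := ltr_add_invr e0; rewrite add0r => ne; exists n; exact: ne.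
exists ([:: f], n) => -[s m] /= [fs nm]; have [_ /= qx] := xP (s, m).
have fs' : f \in s by apply: fs; rewrite inE.
apply: lt_trans ne; apply: (@lt_le_trans _ _ (m.+1%:R^-1)); last first.
  by rewrite lef_pV2 ?posrE// ler_nat.
rewrite -ltr_sqr ?nnegrE ?rnorm_ge0//; apply: le_lt_trans qx.
rewrite /q (big_rem f)//= lerDl; apply: sumr_ge0 => h _; exact: sqr_ge0.
Qed.

End Goldstine.

Record bilinear_map (R : realType) (X Y Z : normedModType R[i]) := BilinearMap {
  bil :> X -> Y -> Z;
  bil_linear_l : forall y, linear (bil^~ y);
  bil_linear_r : forall x, linear (bil x);
  bil_bounded : exists M : R, forall x y, `|bil x y| <= M%:C * `|x| * `|y| }.

Section Arens.
Context {R : realType} {X Y Z : normedModType R[i]}.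
Variable m : bilinear_map X Y Z.

(* z is the iterated limit w*-lim_i w*-lim_j m (x_i) (y_j), for all bounded nets
   x_i -> phi and y_j -> psi (weak* ). A net is a family indexed by a type with
   a proper filter, such as the filter of tails of a directed set. *)
Definition is_arens_limit (phi : dual (dual X)) (psi : dual (dual Y))
    (z : dual (dual Z)) : Prop :=
  forall (I J : Type) (F : set_system I) (G : set_system J)
         (x : I -> X) (y : J -> Y),
  ProperFilter F -> ProperFilter G ->
  (exists M : R, forall i, `|x i| <= M%:C) ->
  (exists M : R, forall j, `|y j| <= M%:C) ->
  (bidual_embed (x i) : wstar (dual X)) @[i --> F] --> (phi : wstar (dual X)) ->
  (bidual_embed (y j) : wstar (dual Y)) @[j --> G] --> (psi : wstar (dual Y)) ->
  exists2 c : I -> dual (dual Z),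
    forall i, (bidual_embed (m (x i) (y j)) : wstar (dual Z)) @[j --> G]
                --> (c i : wstar (dual Z))
  & (c i : wstar (dual Z)) @[i --> F] --> (z : wstar (dual Z)).

(* The extension of m to biduals given by that iterated limit; it exists and is
   unique by is_arens_limit_adjoint and is_arens_limit_unique below. *)
Definition arens (phi : dual (dual X)) (psi : dual (dual Y)) : dual (dual Z) :=
  get [set z | is_arens_limit phi psi z].

Lemma bil_boundedP :
  exists2 M : R, 0 <= M & forall x y, rnorm (m x y) <= M * rnorm x * rnorm y.
Proof.
have [M mM] := bil_bounded m; exists `|M| => // x y.
rewrite -ler_rnorm; apply: le_trans (mM x y) _.
rewrite !rnormE -!rmorphM lecR ler_wpM2r ?rnorm_ge0//.
by rewrite ler_wpM2r ?rnorm_ge0 ?ler_norm.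
Qed.

Lemma bil_dual_bounded (f : dual Z) (x : X) :
  @bounded_linear R Y R[i]^o (fun y => f (m x y)).
Proof.
apply/bounded_linear_rnorm; split=> [k y y'|].
  by rewrite (bil_linear_r m) dual_linear.
have [M M0 mM] := bil_boundedP.
exists (opnorm f * (M * rnorm x)) => [|y].
  by rewrite !mulr_ge0 ?opnorm_ge0 ?rnorm_ge0.
apply: le_trans (ler_opnorm _ _) _; rewrite -mulrA.
by rewrite ler_wpM2l ?opnorm_ge0.
Qed.

Definition bil_dual f x : dual Y := dual_of (bil_dual_bounded f x).

Lemma opnorm_bil_dual f x (M : R) : 0 <= M ->
  (forall x y, rnorm (m x y) <= M * rnorm x * rnorm y) ->
  opnorm (bil_dual f x) <= opnorm f * M * rnorm x.
Proof.
move=> M0 mM; apply: opnorm_le => [|y].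
  by rewrite !mulr_ge0 ?opnorm_ge0 ?rnorm_ge0.
apply: le_trans (ler_opnorm f _) _; rewrite -!mulrA ler_wpM2l ?opnorm_ge0//.
by rewrite mulrA.
Qed.

Lemma bil_dual_linear f : linear (bil_dual f).
Proof.
move=> k x x'; apply: dualP => y /=.
by rewrite -[LHS]/(f (m _ y)) (bil_linear_l m y) dual_linear.
Qed.

Lemma bidual_dual_bounded (psi : dual (dual Y)) (f : dual Z) :
  @bounded_linear R X R[i]^o (fun x => psi (bil_dual f x)).
Proof.
apply/bounded_linear_rnorm; split=> [k x x'|].
  by rewrite bil_dual_linear dual_linear.
have [M M0 mM] := bil_boundedP.
exists (opnorm psi * (opnorm f * M)) => [|x].
  by rewrite !mulr_ge0 ?opnorm_ge0 ?rnorm_ge0.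
apply: le_trans (ler_opnorm _ _) _; rewrite -mulrA.
by rewrite ler_wpM2l ?opnorm_ge0// opnorm_bil_dual.
Qed.

Definition bidual_dual psi f : dual X := dual_of (bidual_dual_bounded psi f).

Lemma opnorm_bidual_dual psi f (M : R) : 0 <= M ->
  (forall x y, rnorm (m x y) <= M * rnorm x * rnorm y) ->
  opnorm (bidual_dual psi f) <= opnorm psi * M * opnorm f.
Proof.
move=> M0 mM; apply: opnorm_le => [|x].
  by rewrite !mulr_ge0 ?opnorm_ge0 ?rnorm_ge0.
apply: le_trans (ler_opnorm psi _) _; rewrite -!mulrA ler_wpM2l ?opnorm_ge0//.
by rewrite mulrA (mulrC M) opnorm_bil_dual.
Qed.

Lemma arens_adjoint_bounded (phi : dual (dual X)) (psi : dual (dual Y)) :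
  @bounded_linear R (dual Z) R[i]^o (fun f => phi (bidual_dual psi f)).
Proof.
apply/bounded_linear_rnorm; split=> [k f g|].
  rewrite -dual_linear; congr (phi _); apply: dualP => x.
  rewrite -[LHS]/(psi _) -[RHS]/(k * psi _ + psi _) -[RHS](dual_linear psi).
  by congr (psi _); exact: dualP.
have [M M0 mM] := bil_boundedP.
exists (opnorm phi * (opnorm psi * M)) => [|f].
  by rewrite !mulr_ge0 ?opnorm_ge0.
apply: le_trans (ler_opnorm _ _) _; rewrite -mulrA.
by rewrite ler_wpM2l ?opnorm_ge0// opnorm_bidual_dual.
Qed.

Definition arens_adjoint phi psi : dual (dual Z) :=
  dual_of (arens_adjoint_bounded phi psi).

Lemma is_arens_limit_adjoint phi psi :
  is_arens_limit phi psi (arens_adjoint phi psi).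
Proof.
move=> I J F G x y PF PG _ _ /cvg_wstarP xphi /cvg_wstarP ypsi.
exists (fun i => arens_adjoint (bidual_embed (x i)) psi) => [i|].
  by apply/cvg_wstarP => f; exact: (ypsi (bil_dual f (x i))).
by apply/cvg_wstarP => f; exact: (xphi (bidual_dual psi f)).
Qed.

Lemma is_arens_limit_unique phi psi z z' :
  is_arens_limit phi psi z -> is_arens_limit phi psi z' -> z = z'.
Proof.
have [I [F [x [PF xM xphi]]]] := goldstine phi.
have [J [G [y [PG yM ypsi]]]] := goldstine psi.
have bx : exists M : R, forall i, `|x i| <= M%:C.
  by exists (rnorm phi) => i; rewrite -rnormE xM.
have by_ : exists M : R, forall j, `|y j| <= M%:C.
  by exists (rnorm psi) => j; rewrite -rnormE yM.
move=> /(_ _ _ _ _ _ _ PF PG bx by_ xphi ypsi)[c cl cz].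
move=> /(_ _ _ _ _ _ _ PF PG bx by_ xphi ypsi)[c' cl' cz'].
have cc' : c = c'.
  apply/funext => i; apply: dualP => f.
  have /cvg_wstarP/(_ f) h := cl i; have /cvg_wstarP/(_ f) h' := cl' i.
  exact: (cvg_unique _ h h').
apply: dualP => f; move: cz cz'; rewrite -cc' => /cvg_wstarP/(_ f) h.
by move=> /cvg_wstarP/(_ f); exact: (cvg_unique _ h).
Qed.

Lemma is_arens_limit_arens phi psi : is_arens_limit phi psi (arens phi psi).
Proof.
apply: (@getI _ [set z | is_arens_limit phi psi z]).
exact: is_arens_limit_adjoint.
Qed.

Lemma arensE phi psi : arens phi psi = arens_adjoint phi psi.
Proof.
apply: (@is_arens_limit_unique phi psi); first exact: is_arens_limit_arens.
exact: is_arens_limit_adjoint.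
Qed.

Lemma rnorm_arens (M : R) phi psi : 0 <= M ->
  (forall x y, rnorm (m x y) <= M * rnorm x * rnorm y) ->
  rnorm (arens phi psi) <= M * rnorm phi * rnorm psi.
Proof.
move=> M0 mM; rewrite arensE !rnorm_dualE; apply: opnorm_le => [|f].
  by rewrite !mulr_ge0 ?opnorm_ge0.
apply: le_trans (ler_opnorm phi _) _.
rewrite (mulrC M) -!mulrA ler_wpM2l ?opnorm_ge0// mulrA (mulrC M).
exact: opnorm_bidual_dual.
Qed.

Lemma arens_linear_l psi : linear (arens^~ psi).
Proof. by move=> k phi phi'; rewrite !arensE; exact: dualP. Qed.

Lemma arens_linear_r phi : linear (arens phi).
Proof.
move=> k psi psi'; rewrite !arensE; apply: dualP => f.
rewrite -[LHS]/(phi _) -[RHS]/(k * phi _ + phi _) -[RHS](dual_linear phi).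
by congr (phi _); exact: dualP.
Qed.

Lemma arens_bounded :
  exists M : R, forall phi psi, `|arens phi psi| <= M%:C * `|phi| * `|psi|.
Proof.
have [M M0 mM] := bil_boundedP; exists M => phi psi.
by rewrite [`|phi|]rnormE [`|psi|]rnormE -!rmorphM ler_rnorm rnorm_arens.
Qed.

Definition arens_map : bilinear_map (dual (dual X)) (dual (dual Y)) (dual (dual Z)) :=
  BilinearMap arens_linear_l arens_linear_r arens_bounded.

End Arens.

Lemma arensA (R : realType) (U V W P Q S : normedModType R[i])
    (m1 : bilinear_map P W S) (m2 : bilinear_map U V P)
    (m3 : bilinear_map U Q S) (m4 : bilinear_map V W Q) :
  (forall u v w, m1 (m2 u v) w = m3 u (m4 v w)) ->
  forall u v w, arens m1 (arens m2 u v) w = arens m3 u (arens m4 v w).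
Proof.
move=> h u v w; rewrite !arensE; apply: dualP => f.
rewrite -[LHS]/(u _) -[RHS]/(u _); congr (u _); apply: dualP => a.
rewrite -[LHS]/(v _) -[RHS]/(v _); congr (v _); apply: dualP => b.
rewrite -[LHS]/(w _) -[RHS]/(w _); congr (w _); apply: dualP => c.
by rewrite -[LHS]/(f _) -[RHS]/(f _) h.
Qed.

Record banach_algebra (R : realType) (A : completeNormedModType R[i]) :=
  BanachAlgebra {
    ba_mul :> bilinear_map A A A;
    ba_mulA : forall a b c, ba_mul (ba_mul a b) c = ba_mul a (ba_mul b c);
    ba_norm_mul : forall a b, `|ba_mul a b| <= `|a| * `|b| }.

(* The actions are bounded, not necessarily contractive or unital. *)
Record banach_bimodule (R : realType) (A : completeNormedModType R[i])
    (mA : banach_algebra A) (E : completeNormedModType R[i]) :=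
  BanachBimodule {
    lact : bilinear_map A E E;
    ract : bilinear_map E A E;
    lactA : forall a b e, lact (mA a b) e = lact a (lact b e);
    ractA : forall e a b, ract (ract e a) b = ract e (mA a b);
    lractA : forall a e b, ract (lact a e) b = lact a (ract e b) }.

Section DualBimodule.
Context {R : realType} {A E : completeNormedModType R[i]}.
Context {mA : banach_algebra A}.
Variable mE : banach_bimodule mA E.

Lemma dual_lact_bounded (a : A) (f : dual E) :
  @bounded_linear R E R[i]^o (fun e => f (ract mE e a)).
Proof.
apply/bounded_linear_rnorm; split=> [k e e'|].
  by rewrite (bil_linear_l (ract mE) a) dual_linear.
have [M M0 mM] := bil_boundedP (ract mE).
exists (opnorm f * (M * rnorm a)) => [|e].
  by rewrite !mulr_ge0 ?opnorm_ge0 ?rnorm_ge0.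
apply: le_trans (ler_opnorm _ _) _; rewrite -mulrA ler_wpM2l ?opnorm_ge0//.
by rewrite mulrAC.
Qed.

Definition dual_lact_fun a f : dual E := dual_of (dual_lact_bounded a f).

Definition dual_ract_fun (f : dual E) (a : A) : dual E := bil_dual (lact mE) f a.

Lemma dual_lact_linear_l f : linear (dual_lact_fun^~ f).
Proof.
move=> k a b; apply: dualP => e.
by rewrite -[LHS]/(f _) (bil_linear_r (ract mE)) dual_linear.
Qed.

Lemma dual_lact_linear_r a : linear (dual_lact_fun a).
Proof. by move=> k f g; exact: dualP. Qed.

Lemma dual_lact_map_bounded :
  exists M : R, forall a f, `|dual_lact_fun a f| <= M%:C * `|a| * `|f|.
Proof.
have [M M0 mM] := bil_boundedP (ract mE); exists M => a f.
rewrite [`|a|]rnormE [`|f|]rnormE -!rmorphM ler_rnorm.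
apply: opnorm_le => [|e]; first by rewrite !mulr_ge0 ?rnorm_ge0.
apply: le_trans (ler_opnorm f _) _; rewrite [leLHS]mulrC [leRHS]mulrAC.
by rewrite ler_wpM2r ?opnorm_ge0// [leRHS]mulrAC.
Qed.

Lemma dual_ract_linear_l a : linear (dual_ract_fun^~ a).
Proof. by move=> k f g; exact: dualP. Qed.

Lemma dual_ract_linear_r f : linear (dual_ract_fun f).
Proof. exact: bil_dual_linear. Qed.

Lemma dual_ract_map_bounded :
  exists M : R, forall f a, `|dual_ract_fun f a| <= M%:C * `|f| * `|a|.
Proof.
have [M M0 mM] := bil_boundedP (lact mE); exists M => f a.
rewrite [`|a|]rnormE [`|f|]rnormE -!rmorphM ler_rnorm (mulrC M).
exact: opnorm_bil_dual.
Qed.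

Definition dual_lact : bilinear_map A (dual E) (dual E) :=
  BilinearMap dual_lact_linear_l dual_lact_linear_r dual_lact_map_bounded.

Definition dual_ract : bilinear_map (dual E) A (dual E) :=
  BilinearMap dual_ract_linear_l dual_ract_linear_r dual_ract_map_bounded.

Lemma dual_lactA a b f : dual_lact (mA a b) f = dual_lact a (dual_lact b f).
Proof.
by apply: dualP => e; rewrite -[LHS]/(f _) -[RHS]/(f _) ractA.
Qed.

Lemma dual_ractA f a b :
  dual_ract (dual_ract f a) b = dual_ract f (mA a b).
Proof.
by apply: dualP => e; rewrite -[LHS]/(f _) -[RHS]/(f _) lactA.
Qed.

Lemma dual_lractA a f b :
  dual_ract (dual_lact a f) b = dual_lact a (dual_ract f b).
Proof.
by apply: dualP => e; rewrite -[LHS]/(f _) -[RHS]/(f _) lractA.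
Qed.

(* E^* with <a f, e> = <f, e a> and <f a, e> = <f, a e> *)
Definition dual_bimodule : banach_bimodule mA (dual E) :=
  BanachBimodule dual_lactA dual_ractA dual_lractA.

End DualBimodule.

Section Bidual.
Context {R : realType} {A : completeNormedModType R[i]}.
Variable mA : banach_algebra A.

Let arens_norm (a b : dual (dual A)) :
  `|arens_map mA a b| <= `|a| * `|b|.
Proof.
rewrite [`|a|]rnormE [`|b|]rnormE -rmorphM ler_rnorm -[rnorm a]mul1r.
apply: rnorm_arens => // x y; rewrite mul1r -lecR rmorphM /= -!rnormE.
exact: ba_norm_mul.
Qed.

(* A^** with the first Arens product, normed as the bidual *)
Definition arens_algebra : banach_algebra (dual (dual A)) :=
  @BanachAlgebra R (dual (dual A)) (arens_map mA)
    (arensA (@ba_mulA _ _ mA)) arens_norm.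

(* B^** over A^**; b a is the iterated limit with the net of b outermost *)
Definition arens_bimodule (B : completeNormedModType R[i])
    (mB : banach_bimodule mA B) :
    banach_bimodule arens_algebra (dual (dual B)) :=
  @BanachBimodule R (dual (dual A)) arens_algebra (dual (dual B))
    (arens_map (lact mB)) (arens_map (ract mB))
    (arensA (lactA mB)) (arensA (ractA mB)) (arensA (lractA mB)).

End Bidual.

Section Derivations.
Context {R : realType}.

Section Def.
Context {A : completeNormedModType R[i]} {mA : banach_algebra A}.
Context {E : completeNormedModType R[i]} (mE : banach_bimodule mA E).

Definition derivation (D : A -> E) : Prop :=
  bounded_linear D /\
  forall x y, D (mA x y) = lact mE x (D y) + ract mE (D x) y.

Definition inner (D : A -> E) : Prop :=
  exists e : E, forall c, D c = lact mE c e - ract mE e c.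

(* H^1(A, E) = 0: the quotient of derivations by inner derivations is zero *)
Definition H1_trivial : Prop := forall D, derivation D -> inner D.

End Def.

Definition super_amenable (A : completeNormedModType R[i])
    (mA : banach_algebra A) : Prop :=
  forall (E : completeNormedModType R[i]) (mE : banach_bimodule mA E),
    H1_trivial mE.

(* From here on the algebra is a dual space P^*, with its weak* topology
   sigma(P^*, P), and the bimodule is a dual space X^*. *)
Section WeakStar.
Context {P : completeNormedModType R[i]} {mC : banach_algebra (dual P)}.

(* H^1_{w*} = 0 *)
Definition H1_wstar_trivial (X : completeNormedModType R[i])
    (mE : banach_bimodule mC (dual X)) : Prop :=
  forall D : dual P -> dual X, derivation mE D ->
    continuous (D : wstar P -> wstar X) -> inner mE D.

Definition normal_bimodule (X : completeNormedModType R[i])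
    (mE : banach_bimodule mC (dual X)) : Prop :=
  forall f : dual X,
    continuous ((fun c => lact mE c f) : wstar P -> wstar X) /\
    continuous ((fun c => ract mE f c) : wstar P -> wstar X).

End WeakStar.

Definition connes_amenable (P : completeNormedModType R[i])
    (mC : banach_algebra (dual P)) : Prop :=
  forall (X : completeNormedModType R[i]) (mX : banach_bimodule mC X),
    normal_bimodule (dual_bimodule mX) -> H1_wstar_trivial (dual_bimodule mX).

Definition has_bounded_left_approximate_identity
    (A : completeNormedModType R[i]) (mA : banach_algebra A) : Prop :=
  exists (I : Type) (F : set_system I) (e : I -> A),
    [/\ ProperFilter F, (exists M : R, forall i, `|e i| <= M%:C) &
        forall a, mA (e i) a @[i --> F] --> a].

End Derivations.

(* Main.v *)
Require Import Defs.
From mathcomp Require Import all_boot all_order all_algebra.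
From mathcomp Require Import complex.
From mathcomp Require Import all_classical all_reals all_analysis.

Set Implicit Arguments.
Unset Strict Implicit.
Unset Printing Implicit Defensive.

Import Order.TTheory GRing.Theory Num.Theory.
Import numFieldNormedType.Exports.

Local Open Scope classical_set_scope.
Local Open Scope complex_scope.
Local Open Scope ring_scope.

(** A derivation [D] on [A^**] restricts to a derivation on [A], with values in
    the same space regarded as an [A]-bimodule through the canonical embedding
    of [A] ([restricted_bimodule]). Super-amenability makes the restriction
    inner: some [e] satisfies [D a = a e - e a] for all [a] in [A]
    ([super_amenable_restriction_inner]). By Goldstine's theorem [A] is weak*
    dense in [A^**], so the identity extends to all of [A^**] as soon as
    [c |-> c e] and [c |-> e c] are weak* continuous
    ([inner_of_wstar_continuous]).

    For a normal dual bimodule that continuity is the definition of normality,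
    which gives Connes-amenability.

    For [B^**] with [B = X^*], the map [c |-> c e] is always weak* continuous
    for the first Arens product, but [c |-> e c] may fail to be so; it is when
    [e] comes from [B]. Let [b] in [B = X^*] be the restriction of
    [e], a functional on [B^*], to [X]. For [a] in [A] and [f] in [B^*] one has
    [(a e) f = e (f a)] and [(e a) f = e (a f)], and both [f a] and [a f] lie
    in [X] by hypothesis; hence [a e = a b] and [e a = b a]
    ([arens_embed_restriction]), and [b] implements [D] on [A] just as [e]
    does. *)

(** * Weak* continuous maps out of a bidual *)

Section WeakStarMaps.
Context {R : realType}.
Implicit Types V W : normedModType R[i].

Lemma wstar_continuousB V W (f g : dual V -> dual W) :
  continuous (f : wstar V -> wstar W) -> continuous (g : wstar V -> wstar W) ->
  continuous ((fun c => f c - g c) : wstar V -> wstar W).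
Proof.
move=> cf cg c; have FF := nbhs_filter (c : wstar V).
have /(cvg_wstarP FF) fc := cf c; have /(cvg_wstarP FF) gc := cg c.
by apply/(cvg_wstarP FF) => w; exact: cvgB (fc w) (gc w).
Qed.

(** The condition says that [f] is the adjoint of a map between the preduals. *)
Lemma wstar_continuous_of_predual V W (f : dual V -> dual W) :
  (forall w, exists v, forall c, f c w = c v) ->
  continuous (f : wstar V -> wstar W).
Proof.
move=> fE c; have FF := nbhs_filter (c : wstar V).
apply/(cvg_wstarP FF) => w; have [v wv] := fE w.
under eq_fun do rewrite wv.
by rewrite wv; move: v {wv}; apply/(cvg_wstarP FF).
Qed.

(** This is the weak* density of a space in its bidual, as given by Goldstine's
    theorem, together with the Hausdorff property of the weak* topology. *)
Lemma wstar_continuous_eq V W (f g : dual (dual V) -> dual W) :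
  continuous (f : wstar (dual V) -> wstar W) ->
  continuous (g : wstar (dual V) -> wstar W) ->
  (forall v, f (bidual_embed v) = g (bidual_embed v)) -> f =1 g.
Proof.
move=> cf cg fg c; have [I [F [v [PF _ vc]]]] := goldstine c.
apply: dualP => w.
have fc := cvg_comp _ _ vc (cf c); have gc := cvg_comp _ _ vc (cg c).
move/cvg_wstarP : fc => /(_ w) fc; move/cvg_wstarP : gc => /(_ w) gc.
apply: (cvg_unique _ fc) => //.
have -> : (fun i => f (bidual_embed (v i)) w) = fun i => g (bidual_embed (v i)) w.
  by apply/funext => i; rewrite fg.
exact: gc.
Qed.

End WeakStarMaps.

(** * The canonical embedding and the Arens extension *)

Section Embedding.
Context {R : realType}.
Implicit Types V W Z : normedModType R[i].

Lemma bidual_embed_linear V : linear (@bidual_embed R V).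
Proof. by move=> k x y; apply: dualP => f; exact: dual_linear. Qed.

Lemma rnorm_bidual_embed V (x : V) : rnorm (bidual_embed x) <= rnorm x.
Proof.
rewrite rnorm_dualE; apply: opnorm_le; first exact: rnorm_ge0.
by move=> f; rewrite [leRHS]mulrC; exact: (ler_opnorm f x).
Qed.

Lemma arens_embed V W Z (m : bilinear_map V W Z) x y :
  arens m (bidual_embed x) (bidual_embed y) = bidual_embed (m x y).
Proof. by rewrite arensE; exact: dualP. Qed.

Lemma arens_wstar_continuous_l V W Z (m : bilinear_map V W Z) psi :
  continuous ((arens m)^~ psi : wstar (dual V) -> wstar (dual Z)).
Proof.
by apply: wstar_continuous_of_predual => f; exists (bidual_dual m psi f) => c; rewrite arensE.
Qed.

(** The first Arens extension need not be weak* continuous in its second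
    argument when the first one is an arbitrary element of the bidual. *)
Lemma arens_embed_wstar_continuous_r V W Z (m : bilinear_map V W Z) x :
  continuous (arens m (bidual_embed x) : wstar (dual W) -> wstar (dual Z)).
Proof.
by apply: wstar_continuous_of_predual => f; exists (bil_dual m f x) => c; rewrite arensE.
Qed.

End Embedding.

(** * Restricting a bimodule and a derivation from the bidual algebra *)

Section Restriction.
Context {R : realType} {A E : completeNormedModType R[i]}.
Context {mA : banach_algebra A}.
Variable mE : banach_bimodule (arens_algebra mA) E.

Let la (a : A) (e : E) : E := lact mE (bidual_embed a) e.
Let ra (e : E) (a : A) : E := ract mE e (bidual_embed a).

Let la_linear_l e : linear (la^~ e).
Proof. by move=> k a b; rewrite /la bidual_embed_linear (bil_linear_l (lact mE)). Qed.

Let la_linear_r a : linear (la a).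
Proof. exact: bil_linear_r. Qed.

Let la_bounded : exists M : R, forall a e, `|la a e| <= M%:C * `|a| * `|e|.
Proof.
have [M M0 mM] := bil_boundedP (lact mE); exists M => a e.
rewrite [`|a|]rnormE [`|e|]rnormE -!rmorphM ler_rnorm.
apply: le_trans (mM _ _) _.
by rewrite ler_wpM2r ?rnorm_ge0// ler_wpM2l// rnorm_bidual_embed.
Qed.

Let ra_linear_l a : linear (ra^~ a).
Proof. exact: bil_linear_l. Qed.

Let ra_linear_r e : linear (ra e).
Proof. by move=> k a b; rewrite /ra bidual_embed_linear (bil_linear_r (ract mE)). Qed.

Let ra_bounded : exists M : R, forall e a, `|ra e a| <= M%:C * `|e| * `|a|.
Proof.
have [M M0 mM] := bil_boundedP (ract mE); exists M => e a.
rewrite [`|a|]rnormE [`|e|]rnormE -!rmorphM ler_rnorm.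
apply: le_trans (mM _ _) _.
by rewrite ler_wpM2l ?rnorm_bidual_embed// mulr_ge0// rnorm_ge0.
Qed.

Let embedM a b :
  bidual_embed (mA a b) = arens_algebra mA (bidual_embed a) (bidual_embed b).
Proof. by rewrite -[RHS]/(arens _ _ _) arens_embed. Qed.

Definition restricted_bimodule : banach_bimodule mA E.
Proof.
apply: (@BanachBimodule _ _ mA _
  (BilinearMap la_linear_l la_linear_r la_bounded)
  (BilinearMap ra_linear_l ra_linear_r ra_bounded)) => [a b e|e a b|a e b] /=.
- by rewrite /la embedM lactA.
- by rewrite /ra embedM ractA.
- exact: lractA.
Defined.

Lemma derivation_restriction (D : dual (dual A) -> E) :
  derivation mE D -> derivation restricted_bimodule (D \o @bidual_embed R A).
Proof.
move=> [/bounded_linear_rnorm[lD [M M0 DM]] Dmul]; split.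
  apply/bounded_linear_rnorm; split=> [k a b /=|].
    by rewrite bidual_embed_linear lD.
  exists M => // a; apply: le_trans (DM _) _.
  by rewrite ler_wpM2l ?rnorm_bidual_embed.
by move=> a b; rewrite /comp embedM Dmul.
Qed.

Lemma super_amenable_restriction_inner (D : dual (dual A) -> E) :
  super_amenable mA -> derivation mE D ->
  exists e, forall a, D (bidual_embed a) =
    lact mE (bidual_embed a) e - ract mE e (bidual_embed a).
Proof. by move=> sA /derivation_restriction /(sA _ _). Qed.

End Restriction.

Lemma inner_of_wstar_continuous (R : realType) (A X : completeNormedModType R[i])
    (mA : banach_algebra A) (mE : banach_bimodule (arens_algebra mA) (dual X))
    (D : dual (dual A) -> dual X) (e : dual X) :
  continuous (D : wstar (dual A) -> wstar X) ->
  continuous ((fun c => lact mE c e) : wstar (dual A) -> wstar X) ->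
  continuous ((fun c => ract mE e c) : wstar (dual A) -> wstar X) ->
  (forall a, D (bidual_embed a) =
     lact mE (bidual_embed a) e - ract mE e (bidual_embed a)) ->
  inner mE D.
Proof.
move=> cD cl cr De; exists e.
by apply: wstar_continuous_eq => //; exact: wstar_continuousB.
Qed.

(** * Bimodules with a predual *)

Section Predual.
Context {R : realType}.

Lemma predual_restriction_bounded (X : normedModType R[i])
    (e : dual (dual (dual X))) :
  @bounded_linear R X R[i]^o (fun x => e (bidual_embed x)).
Proof.
apply/bounded_linear_rnorm; split=> [k x y|].
  by rewrite bidual_embed_linear dual_linear.
exists (opnorm e) => [|x]; first exact: opnorm_ge0.
apply: le_trans (ler_opnorm _ _) _.
by rewrite ler_wpM2l ?opnorm_ge0// rnorm_bidual_embed.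
Qed.

Definition predual_restriction (X : normedModType R[i])
    (e : dual (dual (dual X))) : dual X :=
  dual_of (predual_restriction_bounded e).

Variables (A X : completeNormedModType R[i]) (mA : banach_algebra A).
Variable mB : banach_bimodule mA (dual X).

(** On [f] in [B^*] both sides of the first identity evaluate a functional at
    [f a], and both sides of the second at [a f]. These points belong to [X],
    where [e] and its restriction coincide. *)
Lemma arens_embed_restriction (e : dual (dual (dual X))) (a : A) :
  [set lact (dual_bimodule mB) a f | a in setT & f in setT]
    `<=` range (@bidual_embed R X) ->
  [set ract (dual_bimodule mB) f a | f in setT & a in setT]
    `<=` range (@bidual_embed R X) ->
  let b := bidual_embed (predual_restriction e) in
  arens (lact mB) (bidual_embed a) e = arens (lact mB) (bidual_embed a) b /\
  arens (ract mB) e (bidual_embed a) = arens (ract mB) b (bidual_embed a).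
Proof.
move=> lactX ractX b; have eE (g : dual (dual X)) : range (@bidual_embed R X) g ->
  e g = b g by move=> [x _ <-].
split; rewrite !arensE; apply: dualP => f.
  by apply: eE; apply: ractX; exists f => //; exists a.
apply: eE; apply: lactX; exists a => //; exists f => //.
(* The adjoint [bidual_dual] of [ract mB] at the embedded [a] sends [f] to
   [a f]. *)
exact: dualP.
Qed.

End Predual.

Theorem mainTheorem4 (R : realType) (A : completeNormedModType R[i])
    (mA : banach_algebra A) :
  super_amenable mA ->
  connes_amenable (arens_algebra mA) /\
  (has_bounded_left_approximate_identity mA ->
   forall (X : completeNormedModType R[i]) (mB : banach_bimodule mA (dual X)),
     [set lact (dual_bimodule mB) a f | a in setT & f in setT]
       `<=` range (@bidual_embed R X) ->
     [set ract (dual_bimodule mB) f a | f in setT & a in setT]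
       `<=` range (@bidual_embed R X) ->
     H1_wstar_trivial (arens_bimodule mB)).
Proof.
move=> sA; split=> [X mX nX D dD cD|_ X mB lX rX D dD cD].
  have [e De] := super_amenable_restriction_inner sA dD.
  by have [cl cr] := nX e; exact: inner_of_wstar_continuous De.
have [e De] := super_amenable_restriction_inner sA dD.
apply: (@inner_of_wstar_continuous _ _ _ _ _ _
  (bidual_embed (predual_restriction e))) => // [||a].
- exact: arens_wstar_continuous_l.
- exact: arens_embed_wstar_continuous_r.
- by rewrite De /=; have [-> ->] := arens_embed_restriction e a lX rX.
Qed.
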